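(* Let $F:\mathbb{R}^n\to\mathbb{R}^n$ satisfy $F(0)=0$ and be globally Lipschitz continuous with modulus $L>0$, i.e. $\|F(x)-F(y)\|\le L\|x-y\|$ for all $x,y\in\mathbb{R}^n$. Let the origin be a globally exponentially stable equilibrium point of $\dot x=F(x)$, and let $(k_1,k_2,k_3)$ be the positive parameters of a continuously differentiable Lyapunov function $V:\mathbb{R}^n\to\mathbb{R}$ certifying this, i.e. $k_1\|x\|^2\le V(x)\le k_2\|x\|^2$ and $\langle\nabla V(x),F(x)\rangle\le -k_3\|x\|^2$ for all $x\in\mathbb{R}^n$. Then, for any $\eta>0$ and $\lambda\in(0,1)$, the origin is a globally finite-time stable equilibrium point of $$\dot x=\sigma(x)F(x),\qquad \sigma(x)=\begin{cases}0, & F(x)=0,\\ \eta\,\|F(x)\|^{-\lambda}, & \text{otherwise.}\end{cases}$$ Moreover, the settling time is upper bounded by $$T(x(0))\le \frac{2k_2L^{\lambda}}{k_3\,\eta\,\lambda}\,\|x(0)\|^{\lambda}\qquad\text{for every initial condition } x(0)\in\mathbb{R}^n.$$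
   Context: $\|\cdot\|$ is the Euclidean norm and $\langle\cdot,\cdot\rangle$ the Euclidean inner product on $\mathbb{R}^n$. Global exponential stability: the origin is a globally exponentially stable equilibrium point of $\dot x=F(x)$ if there are positive constants $M,\rho$, independent of $x(0)$, such that every solution satisfies $\|x(t)\|\le M e^{-\rho t}\|x(0)\|$ for all $t\ge 0$. Global finite-time stability: the origin is a globally finite-time stable equilibrium point of a system $\dot x=G(x)$ with $G(0)=0$ if (i) it is stable in the sense of Lyapunov, and (ii) there is a settling-time function $T:\mathbb{R}^n\to[0,\infty)$ such that the solution starting from $x(0)$ satisfies $\lim_{t\to T(x(0))}x(t)=0$. Here $T(x(0))$ is the first time at which the solution starting at $x(0)$ reaches the origin, so $T(0)=0$. *)

(* Defs.v *)
From HB Require Import structures.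
From mathcomp Require Import all_boot all_order all_algebra.
From mathcomp Require Import all_classical all_reals all_analysis.

Set Implicit Arguments.
Unset Strict Implicit.
Unset Printing Implicit Defensive.

Import Order.TTheory GRing.Theory Num.Theory.
Import numFieldNormedType.Exports.

Local Open Scope classical_set_scope.
Local Open Scope ring_scope.

(* The library norm `|x| on 'rV[R]_n is the sup norm, so the Euclidean norm is
   defined here.  Limits, continuity and differentiability below use the library
   topology of 'rV[R]_n, which is also the Euclidean one. *)
Definition dot (R : realType) (n : nat) (u v : 'rV[R]_n) : R :=
  \sum_(i < n) u ord0 i * v ord0 i.

Definition enorm (R : realType) (n : nat) (u : 'rV[R]_n) : R :=
  Num.sqrt (dot u u).

Definition lipschitz_modulus (R : realType) (n : nat)
    (F : 'rV[R]_n -> 'rV[R]_n) (L : R) : Prop :=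
  forall x y, enorm (F x - F y) <= L * enorm (x - y).

Definition gradient (R : realType) (n : nat) (V : 'rV[R]_n -> R)
    (x : 'rV[R]_n) : 'rV[R]_n :=
  \row_(i < n) 'D_(delta_mx ord0 i) V x.

Definition continuously_differentiable (R : realType) (n : nat)
    (V : 'rV[R]_n -> R) : Prop :=
  (forall x, differentiable V x) /\ continuous (gradient V).

(* x' = G(x) on [0, +oo[.  Only the values of x on [0, +oo[ matter: the
   difference quotient at t is restricted to t + h >= 0, hence it is the usual
   derivative for t > 0 and the right derivative at t = 0. *)
Definition solution (R : realType) (n : nat) (G : 'rV[R]_n -> 'rV[R]_n)
    (x : R -> 'rV[R]_n) : Prop :=
  forall t, 0 <= t ->
    h^-1 *: (x (t + h) - x t) @[h --> within [set h | 0 <= t + h] (0 : R)^']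
      --> G (x t).

(* x is "the" solution starting from x0: it is a solution, and any other one
   agrees with it on [0, +oo[. *)
Definition the_solution (R : realType) (n : nat) (G : 'rV[R]_n -> 'rV[R]_n)
    (x0 : 'rV[R]_n) (x : R -> 'rV[R]_n) : Prop :=
  [/\ solution G x, x 0 = x0 &
      forall y, solution G y -> y 0 = x0 -> forall t, 0 <= t -> y t = x t].

Definition globally_exponentially_stable (R : realType) (n : nat)
    (F : 'rV[R]_n -> 'rV[R]_n) : Prop :=
  F 0 = 0 /\
  exists M rho : R, [/\ 0 < M, 0 < rho &
    forall x, solution F x ->
      forall t, 0 <= t -> enorm (x t) <= M * expR (- rho * t) * enorm (x 0)].

Definition exponential_lyapunov_function (R : realType) (n : nat)
    (F : 'rV[R]_n -> 'rV[R]_n) (V : 'rV[R]_n -> R) (k1 k2 k3 : R) : Prop :=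
  [/\ continuously_differentiable V,
      forall x, k1 * enorm x ^+ 2 <= V x <= k2 * enorm x ^+ 2 &
      forall x, dot (gradient V x) (F x) <= - k3 * enorm x ^+ 2].

Definition lyapunov_stable (R : realType) (n : nat)
    (G : 'rV[R]_n -> 'rV[R]_n) : Prop :=
  forall eps : R, 0 < eps -> exists2 delta : R, 0 < delta &
    forall x, solution G x -> enorm (x 0) < delta ->
      forall t, 0 <= t -> enorm (x t) < eps.

(* The limit at T x0 is taken within [0, +oo[, where the solution lives.  The
   existence of the solution is part of the requirement. *)
Definition settling_time_function (R : realType) (n : nat)
    (G : 'rV[R]_n -> 'rV[R]_n) (T : 'rV[R]_n -> R) : Prop :=
  forall x0, 0 <= T x0 /\
    exists x : R -> 'rV[R]_n,
      [/\ the_solution G x0 x,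
          x t @[t --> within [set t | 0 <= t] (nbhs (T x0))] --> (0 : 'rV[R]_n),
          x (T x0) = 0 &
          forall t, 0 <= t < T x0 -> x t <> 0].

Definition globally_finite_time_stable (R : realType) (n : nat)
    (G : 'rV[R]_n -> 'rV[R]_n) : Prop :=
  [/\ G 0 = 0, lyapunov_stable G & exists T, settling_time_function G T].

Definition sigma (R : realType) (n : nat) (F : 'rV[R]_n -> 'rV[R]_n)
    (eta lambda : R) (x : 'rV[R]_n) : R :=
  if F x == 0 then 0 else eta * enorm (F x) `^ (- lambda).

(* Main.v *)
(* Outside the origin the vector field [sigma F] is a positive multiple of [F],
   so the two systems have the same orbits.  If [y' = F y] with [y 0 = x0 <> 0],
   then [x t = y (S t)], where [S] is the inverse of the clock [tau] given by
   [tau 0 = 0] and [tau' = enorm (F y) ^ lambda / eta].  Along [y] the function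
   [V ^ (lambda / 2)] decreases at least at a fixed multiple of the rate of
   [tau], so [tau] is bounded: with [T] its supremum, [x] reaches the origin at
   time [T] and is prolonged by 0.  Conversely Gronwall's inequality, applied
   with the integrated time change as clock, shows that every solution is of the
   form [y (S t)] as long as it does not vanish, although [sigma F] is not
   Lipschitz at the origin. *)
Require Import Defs.
From HB Require Import structures.
From mathcomp Require Import all_boot all_order all_algebra.
From mathcomp Require Import all_classical all_reals all_analysis.
From mathcomp Require Import ring lra.

Set Implicit Arguments.
Unset Strict Implicit.
Unset Printing Implicit Defensive.

Import Order.TTheory GRing.Theory Num.Theory.
Import numFieldNormedType.Exports.

Local Open Scope classical_set_scope.
Local Open Scope ring_scope.

(** * Derivatives of curves, monotonicity and mean value inequalities *)

Lemma is_derive_rowP (R : realType) (n : nat) (x : R -> 'rV[R]_n) (t : R)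
    (v : 'rV[R]_n) :
  is_derive t (1 : R) x v <->
  forall i, is_derive t (1 : R) (fun s => x s ord0 i) (v ord0 i).
Proof.
split=> [[dx <-] i|dx].
  have dxi := (derivable_mxP x t (1 : R)).1 dx ord0 i.
  by apply: DeriveDef => //; rewrite derive_mx// mxE.
have dx' : derivable x t (1 : R).
  by apply/derivable_mxP => i j; rewrite ord1; exact: (dx j).(ex_derive).
apply: DeriveDef => //; apply/rowP => i.
by rewrite derive_mx// mxE (dx i).(derive_val).
Qed.

Lemma is_derive1_continuous (R : realType) (W : normedModType R) (x : R -> W)
    (v : W) (t : R) : is_derive t (1 : R) x v -> {for t, continuous x}.
Proof.
by move=> [dx _]; apply: differentiable_continuous; exact/derivable1_diffP.
Qed.

Lemma is_derive1_reparam (R : realType) (n : nat) (y : R -> 'rV[R]_n)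
    (S : R -> R) (t s' : R) (v : 'rV[R]_n) :
  is_derive (S t) (1 : R) y v -> is_derive t (1 : R) S s' ->
  is_derive t (1 : R) (fun r => y (S r)) (s' *: v).
Proof.
move=> /is_derive_rowP dy dS; apply/is_derive_rowP => i.
rewrite mxE mulrC.
exact: (@is_derive1_comp _ (fun s => y s ord0 i) S).
Qed.

(** Chain rule: expanding [v] on the canonical basis turns the differential of [V] into the partial
    derivatives that make up [gradient]. *)
Lemma is_derive1_gradient (R : realType) (n : nat) (V : 'rV[R]_n -> R)
    (x : R -> 'rV[R]_n) (t : R) (v : 'rV[R]_n) :
  differentiable V (x t) -> is_derive t (1 : R) x v ->
  is_derive t (1 : R) (fun s => V (x s)) (dot (gradient V (x t)) v).
Proof.
move=> dV [dx vE].
have dx' : differentiable x t by exact/derivable1_diffP.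
have dVx : differentiable (V \o x) t by exact: differentiable_comp.
apply: DeriveDef; first exact/derivable1_diffP.
rewrite [LHS](deriveE (1 : R) dVx) diff_comp//=.
rewrite -(deriveE (1 : R) dx') vE.
rewrite {1}(row_sum_delta v) linear_sum; apply: eq_bigr => i _.
by rewrite linearZ /= mxE (deriveE _ dV) mulrC.
Qed.

Lemma is_derive1_nondecreasing (R : realType) (f f' : R -> R) (a b : R) :
  a <= b ->
  (forall t : R, a <= t <= b -> is_derive t (1 : R) f (f' t)) ->
  (forall t : R, a <= t <= b -> 0 <= f' t) -> f a <= f b.
Proof.
move=> ab df f'0.
have [||c cab E] := @MVT_segment R f f' a b ab.
- by move=> t; rewrite in_itv/= => /andP[/ltW ? /ltW ?]; apply: df; apply/andP.
- apply: continuous_in_subspaceT => t; rewrite inE/= in_itv/= => tab.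
  exact: is_derive1_continuous (df t tab).
by rewrite -subr_ge0 E mulr_ge0 ?subr_ge0// f'0.
Qed.

Lemma is_derive1_increasing (R : realType) (f f' : R -> R) (a b : R) : a < b ->
  (forall t : R, a <= t <= b -> is_derive t (1 : R) f (f' t)) ->
  (forall t : R, a <= t <= b -> 0 < f' t) -> f a < f b.
Proof.
move=> ab df f'0.
have [||c cab E] := @MVT R f f' a b ab.
- by move=> t; rewrite in_itv/= => /andP[/ltW ? /ltW ?]; apply: df; apply/andP.
- apply: continuous_in_subspaceT => t; rewrite inE/= in_itv/= => tab.
  exact: is_derive1_continuous (df t tab).
rewrite -subr_gt0 E mulr_gt0 ?subr_gt0// f'0//.
by move: cab; rewrite in_itv/= => /andP[/ltW-> /ltW->].
Qed.

Lemma is_derive1_eq_increment (R : realType) (f g h : R -> R) (a b : R) :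
  a <= b ->
  (forall t : R, a <= t <= b -> is_derive t (1 : R) f (h t)) ->
  (forall t : R, a <= t <= b -> is_derive t (1 : R) g (h t)) ->
  f b - f a = g b - g a.
Proof.
move=> ab df dg; apply/eqP; rewrite eq_le; apply/andP; split.
  have H := is_derive1_nondecreasing ab
    (fun t tab => is_deriveB (dg t tab) (df t tab)).
  have : g a - f a <= g b - f b by apply: H => t _; rewrite subrr.
  lra.
have H := is_derive1_nondecreasing ab
  (fun t tab => is_deriveB (df t tab) (dg t tab)).
have : f a - g a <= f b - g b by apply: H => t _; rewrite subrr.
lra.
Qed.

Lemma coord_le_normr (R : realType) (n : nat) (u : 'rV[R]_n) i :
  `|u ord0 i| <= `|u|.
Proof.
rewrite [leRHS]/Num.Def.normr/= mx_normrE.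
exact: (le_bigmax _ (fun ij => `|u ij.1 ij.2|) (ord0, i)).
Qed.

(** For the sup norm it suffices that [g + x_j] and [g - x_j] are nondecreasing for each coordinate
    [j], so no vector-valued integral is involved. *)
Lemma mvt_norm (R : realType) (n : nat) (x x' : R -> 'rV[R]_n)
    (g g' : R -> R) (a b : R) : a <= b ->
  (forall t : R, a <= t <= b -> is_derive t (1 : R) x (x' t)) ->
  (forall t : R, a <= t <= b -> is_derive t (1 : R) g (g' t)) ->
  (forall t : R, a <= t <= b -> `|x' t| <= g' t) ->
  `|x b - x a| <= g b - g a.
Proof.
move=> ab dx dg xg.
have gab : g a <= g b.
  apply: (is_derive1_nondecreasing ab dg) => t tab.
  exact: le_trans (xg t tab).
rewrite {1}/Num.Def.normr/= mx_normrE bigmax_le ?subr_ge0// => -[i j] _ /=.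
rewrite ord1 !mxE {i}.
have dxj t (tab : a <= t <= b) := (is_derive_rowP _ _ _).1 (dx t tab) j.
have xgj t (tab : a <= t <= b) : - g' t <= x' t ord0 j <= g' t.
  by rewrite -ler_norml (le_trans (coord_le_normr _ _))// xg.
have lo := is_derive1_nondecreasing ab
  (fun t tab => is_deriveD (dg t tab) (dxj t tab)).
have hi := is_derive1_nondecreasing ab
  (fun t tab => is_deriveB (dg t tab) (dxj t tab)).
have {}lo : g a + x a ord0 j <= g b + x b ord0 j.
  by apply: lo => t /xgj; lra.
have {}hi : g a - x a ord0 j <= g b - x b ord0 j.
  by apply: hi => t /xgj; lra.
by rewrite ler_norml; lra.
Qed.

(** * Antiderivatives on the whole line *)

Lemma continuous_max0 (R : realType) : continuous (fun t : R => Num.max 0 t).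
Proof.
by move=> t; apply: (@continuous_max _ _ (cst 0) id) => //; exact: cvg_cst.
Qed.

(** Freezing [h] at [h 0] for negative times gives a two-sided derivative at 0, in the form that
    [prolonged_solution] uses. *)
Lemma continuous_antiderivative (R : realType) (h : R -> R) : continuous h ->
  exists2 H : R -> R, H 0 = 0 &
    forall t : R, is_derive t (1 : R) H (h (Num.max 0 t)).
Proof.
move=> hc.
(* [k] vanishes on ]-oo, 0], hence is integrable on every ]-oo, u]. *)
pose k t := h (Num.max 0 t) - h 0.
have k0 t : t <= 0 -> k t = 0 by move=> t0; rewrite /k (max_idPl t0) subrr.
have kc : continuous k.
  move=> t; apply: cvgB; last exact: cvg_cst.
  by apply: (continuous_comp (@continuous_max0 R t)); exact: hc.
pose mu := @lebesgue_measure R.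
have kint u : mu.-integrable `]-oo, u] (EFin \o k).
  have k0u : mu.-integrable `[0, u] (EFin \o k).
    apply: continuous_compact_integrable; first exact: segment_compact.
    exact: continuous_subspaceT.
  have kT : mu.-integrable setT ((EFin \o k) \_ `[0, u]).
    by rewrite -integrable_mkcond//; exact: measurable_itv.
  have : mu.-integrable `]-oo, u] ((EFin \o k) \_ `[0, u]).
    by apply: integrableS kT => //; exact: measurable_itv.
  apply: eq_integrable => // t; rewrite inE/= in_itv/= => tu.
  rewrite patchE; case: ifPn => //; rewrite notin_setE/= in_itv/= tu andbT.
  by move=> /negP; rewrite -ltNge => /ltW /k0 ->.
pose K t := (\int[mu]_(s in `]-oo, t]) k s)%R.
have [{}K K0 dK] : exists2 K : R -> R, K 0 = 0 &
    forall t : R, is_derive t (1 : R) K (k t).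
  exists K.
    rewrite /K (@eq_Rintegral _ _ _ _ _ (cst 0)).
      by rewrite /Rintegral integral0.
    by move=> t; rewrite inE/= in_itv/= => /k0 ->.
  move=> t.
  have [dK K'] :=
    continuous_FTC1 (ltr_pwDr ltr01 (lexx t)) (kint _) (ltNyr _) (kc t).
  by split; [exact: dK|rewrite -derive1E; exact: K'].
(* The linear term restores the constant [h 0] subtracted in [k]. *)
exists (K + h 0 \*: (@id R)) => [|t].
  by rewrite -[LHS]/(K 0 + h 0 * 0) K0 mulr0 addr0.
apply: (is_derive_eq
  (is_deriveD (dK t) (is_deriveZ (h 0) (is_derive_id t (1 : R))))).
by rewrite /k /GRing.scale/= mulr1 subrK.
Qed.

(** * Solutions on the half-line and their prolongation *)

Lemma is_derive1P (R : realType) (n : nat) (x : R -> 'rV[R]_n) (t : R)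
    (v : 'rV[R]_n) :
  is_derive t (1 : R) x v <->
  h^-1 *: (x (t + h) - x t) @[h --> (0 : R)^'] --> v.
Proof.
have E : (fun h : R => h^-1 *: ((x \o shift t) (h *: (1 : R)) - x t)) =
         (fun h => h^-1 *: (x (t + h) - x t)).
  by apply: funext => h /=; rewrite [h *: _]mulr1 [h + t]addrC.
split=> [[cx <-]|xv]; first by rewrite /derive -E; exact: cx.
split; first by apply/cvg_ex; exists v; rewrite E.
by apply/cvg_lim => //; rewrite E.
Qed.

Lemma is_derive1_solution (R : realType) (n : nat) (G : 'rV[R]_n -> 'rV[R]_n)
    (x : R -> 'rV[R]_n) :
  (forall t : R, 0 <= t -> is_derive t (1 : R) x (G (x t))) -> solution G x.
Proof.
move=> dx t /dx/is_derive1P; apply: cvg_trans.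
by apply: cvg_app; exact: cvg_within.
Qed.

(* A solution on [0, +oo[ is prolonged affinely to negative times, which makes
   it derivable on the whole line. *)
Definition prolonged_solution (R : realType) (n : nat)
    (G : 'rV[R]_n -> 'rV[R]_n) (z : R -> 'rV[R]_n) : Prop :=
  forall t : R, is_derive t (1 : R) z (G (z (Num.max 0 t))).

Lemma solution_prolong (R : realType) (n : nat) (G : 'rV[R]_n -> 'rV[R]_n)
    (x : R -> 'rV[R]_n) : solution G x ->
  exists2 z : R -> 'rV[R]_n, (forall t : R, 0 <= t -> z t = x t) &
    prolonged_solution G z.
Proof.
move=> solx; pose z t := if 0 <= t then x t else x 0 + t *: G (x 0).
have zx t : 0 <= t -> z t = x t by rewrite /z => ->.
have zN t : t < 0 -> z t = x 0 + t *: G (x 0) by rewrite /z leNgt => ->.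
exists z => // t; rewrite (zx (Num.max 0 t)) ?le_max ?lexx//.
apply/is_derive1P/cvgrPdist_le => e e0.
rewrite near_withinE; have [t0|t0|t0] := ltrgtP 0 t.
- have /cvgrPdist_le/(_ e e0) := solx t (ltW t0).
  rewrite near_withinE near_withinE => H; near=> h => h0.
  have th : 0 <= t + h.
    suff : `|h| < t by rewrite ltr_norml => /andP[]; lra.
    by near: h; apply: (@nbhs0_lt R R^o).
  by rewrite !zx ?(ltW t0)//; apply: (near H h).
- near=> h => h0.
  have th : t + h < 0.
    suff : `|h| < - t by rewrite ltr_norml => /andP[]; lra.
    by near: h; apply: (@nbhs0_lt R R^o); rewrite oppr_gt0.
  rewrite !zN// opprD addrACA subrr add0r -scalerBl.
  by rewrite addrAC subrr add0r scalerA mulVf// scale1r subrr normr0 ltW.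
(* At 0 the right quotient converges by hypothesis, and the left one is constantly [G (x 0)]. *)
- rewrite -t0; have /cvgrPdist_le/(_ e e0) := solx 0 (lexx 0).
  rewrite near_withinE near_withinE => H; near=> h => h0.
  have [th|th] := leP 0 (0 + h).
    by rewrite !zx//; apply: (near H h).
  rewrite zN// zx// add0r addrAC subrr add0r scalerA mulVf//.
  by rewrite scale1r subrr normr0 ltW.
Unshelve. all: by end_near. Qed.

(** * Picard iteration for a Lipschitz vector field *)

Lemma geometric_increments_cvg (R : realType) (n : nat)
    (u : nat -> 'rV[R]_n) (A : R) :
  (forall k, `|u k.+1 - u k| <= A * 2^-1 ^+ k) ->
  exists2 l : 'rV[R]_n, u @ \oo --> l &
    forall k, `|l - u k| <= 2 * A * 2^-1 ^+ k.
Proof.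
move=> uA.
have A0 : 0 <= A by have := uA 0; rewrite expr0 mulr1; exact: le_trans.
have far k m : `|u (k + m)%N - u k| <= 2 * A * 2^-1 ^+ k.
  (* The telescoped form of the geometric sum is what passes through the induction on [m]. *)
  suff: `|u (k + m)%N - u k| <= 2 * A * (2^-1 ^+ k - 2^-1 ^+ (k + m)).
    move=> /le_trans; apply; rewrite ler_wpM2l ?mulr_ge0//.
    by rewrite gerBl exprn_ge0.
  elim: m => [|m ih]; first by rewrite addn0 !subrr normr0 mulr0.
  rewrite addnS -(subrKA (u (k + m)%N)) (le_trans (ler_normD _ _))//.
  have := uA (k + m)%N; rewrite exprS; move: ih; lra.
have small e : 0 < e -> exists k, 2 * A * 2^-1 ^+ k < e.
  move=> e0; have /cvgrPdist_lt/(_ e e0)[k _ /(_ k (leqnn k))/=] :=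
    @cvg_geometric R (2 * A) 2^-1 (ltac:(by rewrite ger0_norm; lra)).
  rewrite sub0r normrN => /(le_lt_trans (ler_norm _)) kP.
  by exists k.
have cu : cvgn u.
  apply/cauchy_cvgP/cauchy_exP => e e0.
  have [k kP] := small e e0.
  exists (u k); exists k => // m /= km.
  by rewrite -ball_normE/= distrC -(subnKC km) (le_lt_trans (far _ _)).
exists (limn u) => // k.
have ck : `|u m - u k| @[m --> \oo] --> `|limn u - u k|.
  by apply: cvg_norm; apply: cvgB => //; exact: cvg_cst.
rewrite -(cvg_lim _ ck)//; apply: limr_le; first exact: cvgP ck.
by exists k => // m /= km; rewrite -(subnKC km).
Qed.

(** Serves to identify two limits: a distance below every term of a vanishing geometric sequence is
    zero. *)
Lemma le0_geometric (R : realType) (a A : R) :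
  (forall k, a <= A * 2^-1 ^+ k) -> a <= 0.
Proof.
move=> aA; have cg : geometric A 2^-1 @ \oo --> (0 : R).
  by apply: cvg_geometric; rewrite ger0_norm; lra.
rewrite -(cvg_lim _ cg)//; apply: limr_ge; first exact: cvgP cg.
by near=> k; exact: aA.
Unshelve. all: by end_near. Qed.

Lemma continuous_antiderivative_row (R : realType) (n : nat)
    (h : R -> 'rV[R]_n) (x0 : 'rV[R]_n) : continuous h ->
  exists2 H : R -> 'rV[R]_n, H 0 = x0 &
    forall t : R, is_derive t (1 : R) H (h (Num.max 0 t)).
Proof.
move=> hc.
have coord i : {H : R -> R | H 0 = 0 &
    forall t : R, is_derive t (1 : R) H (h (Num.max 0 t) ord0 i)}.
  apply/cid2/(@continuous_antiderivative _ (fun t => h t ord0 i)) => t.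
  apply: (@continuous_comp _ _ _ h (fun v : 'rV[R]_n => v ord0 i)).
    exact: hc.
  exact: coord_continuous.
exists (fun t => \row_i (x0 ord0 i + s2val (coord i) t)) => [|t].
  by apply/rowP => i; rewrite mxE; case: (coord i) => H /= -> _; rewrite addr0.
apply/is_derive_rowP => i.
rewrite [X in is_derive _ _ X](_ : _ =
  cst (x0 ord0 i) + s2val (coord i)); last first.
  by apply/funext => s; rewrite mxE.
rewrite -[X in is_derive _ _ _ X]add0r.
by apply: is_deriveD; exact: (s2valP' (coord i)).
Qed.

Lemma is_derive_expR_scaled (R : realType) (a c t : R) :
  is_derive t (1 : R) (fun s : R => c * expR (a * s)) (c * (a * expR (a * t))).
Proof.
have da : is_derive t (1 : R) (fun s : R => a * s) a.
  apply: (is_derive_eq (is_deriveZ a (is_derive_id t (1 : R)))).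
  by rewrite /GRing.scale/= mulr1.
refine (is_derive_eq
  (is_deriveZ c (is_derive1_comp (is_derive_expR (a * t)) da)) _).
by rewrite /GRing.scale/= [expR _ * _]mulrC.
Qed.

Lemma lipschitz_normr_continuous (R : realType) (n : nat)
    (F : 'rV[R]_n -> 'rV[R]_n) (K : R) : 0 < K ->
  (forall u v, `|F u - F v| <= K * `|u - v|) -> continuous F.
Proof.
move=> K0 FK u; apply/(@cvgrPdist_lt _ _ _ (nbhs u) _ F) => e e0; near=> v.
rewrite (le_lt_trans (FK _ _))// mulrC -ltr_pdivlMr//.
near: v; apply: ((@cvgrPdist_lt _ _ _ (nbhs u) _ id u).1 _ (_ / _) _).
  exact: (@cvg_id _ (nbhs u)).
exact: divr_gt0.
Unshelve. all: by end_near. Qed.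

(* In the weighted norm [sup_t `|x t| / expR (2 * K * t)] the Picard operator is
   a contraction of ratio [1 / 2]. *)
Lemma picard (R : realType) (n : nat) (F : 'rV[R]_n -> 'rV[R]_n) (K : R)
    (x0 : 'rV[R]_n) : 0 < K ->
  (forall u v, `|F u - F v| <= K * `|u - v|) ->
  exists2 y : R -> 'rV[R]_n, y 0 = x0 &
    prolonged_solution F y.
Proof.
move=> K0 FK.
have Fc := lipschitz_normr_continuous K0 FK.
(* Keeping continuity as a premise under the existential makes the Picard operator total; for a
   discontinuous [y] the witness is [y] itself, a junk value. *)
have step_ex (y : R -> 'rV[R]_n) : {z : R -> 'rV[R]_n | continuous y ->
    z 0 = x0 /\ forall t : R, is_derive t (1 : R) z (F (y (Num.max 0 t)))}.
  apply: cid; have [yc|] := pselect (continuous y); last by exists y.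
  have Fyc : continuous (F \o y).
    by move=> t; apply: continuous_comp; [exact: yc|exact: Fc].
  by have [z z0 dz] := continuous_antiderivative_row x0 Fyc; exists z.
pose step y := sval (step_ex y).
have stepP y : continuous y -> step y 0 = x0 /\
  forall t : R, is_derive t (1 : R) (step y) (F (y (Num.max 0 t))).
  by rewrite /step; case: (step_ex y).
have step_cont y : continuous y -> continuous (step y).
  move=> /stepP[_ dy] t; exact: is_derive1_continuous (dy t).
pose Y k := iter k step (cst x0).
have Yc k : continuous (Y k).
  elim: k => [|k ih]; first by move=> t; exact: cvg_cst.
  exact: step_cont.
have step_contract (y z : R -> 'rV[R]_n) (A t : R) :
    continuous y -> continuous z -> 0 <= t ->
    (forall s : R, 0 <= s <= t -> `|y s - z s| <= A * expR (2 * K * s)) ->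
  `|step y t - step z t| <= A / 2 * expR (2 * K * t).
  move=> yc zc t0 yz; have [y0 dy] := stepP y yc; have [z0 dz] := stepP z zc.
  have A0 : 0 <= A.
    have := yz 0; rewrite lexx t0 mulr0 expR0 mulr1 => /(_ isT).
    exact: le_trans.
  have := mvt_norm t0 (fun s _ => is_deriveB (dy s) (dz s))
    (fun s _ => is_derive_expR_scaled (2 * K) (A / 2) s).
  rewrite !fctE y0 z0 subrr subr0 mulr0 expR0 mulr1 => H.
  apply: (le_trans (H _)); last by lra.
  move=> s /andP[s0 st]; rewrite (max_idPr s0) (le_trans (FK _ _))//.
  have := yz s; rewrite s0 st => /(_ isT) yzs.
  have -> : A / 2 * (2 * K * expR (2 * K * s)) = K * (A * expR (2 * K * s)).
    by field.
  by rewrite ler_pM2l.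
(* Chosen so that [C * expR (2 * K * s)] has derivative [|F x0| * expR (2 * K * s)], which bounds
   the speed [|F x0|] of the first iterate. *)
pose C := `|F x0| / (2 * K).
have C0 : 0 <= C by rewrite divr_ge0// mulr_ge0// ltW.
have Yd k (t : R) : 0 <= t ->
    `|Y k.+1 t - Y k t| <= C * expR (2 * K * t) * 2^-1 ^+ k.
  elim: k t => [|k ih] t t0.
    have [Y0 dY] := stepP _ (Yc 0).
    have := mvt_norm t0 (fun s _ => dY s)
      (fun s _ => is_derive_expR_scaled (2 * K) C s).
    rewrite Y0 mulr0 expR0 !mulr1 => H.
    apply: (le_trans (H _)); last by lra.
    move=> s /andP[s0 st]; have -> : C * (2 * K * expR (2 * K * s)) =
      `|F x0| * expR (2 * K * s) by rewrite /C; field; lra.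
    rewrite ler_peMr//; rewrite -expR0 ler_expR.
    by rewrite mulr_ge0// mulr_ge0// ltW.
  have := step_contract _ _ (C * 2^-1 ^+ k) t (Yc k.+1) (Yc k) t0.
  move=> H; apply: (le_trans (H _)); last by rewrite exprS; lra.
  by move=> s /andP[s0 _]; rewrite (le_trans (ih s s0))// mulrAC.
have lim_ex (t : R) : {l : 'rV[R]_n | forall k, `|l - Y k (Num.max 0 t)| <=
    2 * (C * expR (2 * K * Num.max 0 t)) * 2^-1 ^+ k}.
  apply: cid; have t0 : 0 <= Num.max 0 t by rewrite le_max lexx.
  have [l _ lY] := @geometric_increments_cvg _ _
    (fun k => Y k (Num.max 0 t)) _ (fun k => Yd k _ t0).
  by exists l.
pose y (t : R) : 'rV[R]_n := sval (lim_ex t).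
have yY (t : R) k : 0 <= t ->
    `|y t - Y k t| <= 2 * C * 2^-1 ^+ k * expR (2 * K * t).
  move=> t0; rewrite /y; case: (lim_ex t) => l /= /(_ k).
  by rewrite (max_idPr t0); lra.
have small (e b : R) : 0 < e -> exists k, b * 2^-1 ^+ k < e.
  move=> e0; apply: contrapT => /forallNP H.
  have : e <= 0; last by lra.
  by apply: (@le0_geometric _ _ b) => k; rewrite leNgt; exact/negP/H.
(* The values at [t] and at [Num.max 0 t] come from separate choices; they agree because both are
   limits of the same sequence. *)
have y_max (t : R) : y (Num.max 0 t) = y t.
  rewrite /y; case: (lim_ex t) => l' /= l'Y;
  case: (lim_ex (Num.max 0 t)) => l /= lY.
  apply/eqP; rewrite -subr_eq0 -normr_le0; apply: (le0_geometric
    (A := 4 * (C * expR (2 * K * Num.max 0 t)))) => k.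
  have := lY k; rewrite maxA maxxx => lYk; have := l'Y k => l'Yk.
  rewrite -(subrKA (Y k (Num.max 0 t))) (le_trans (ler_normD _ _))//.
  by rewrite (distrC (Y _ _)); lra.
(* The iterates converge uniformly on []-oo, t + 1]], so an argument with three terms of size
   [e / 4] applies. *)
have yc : continuous y.
  move=> t; apply/(@cvgrPdist_le _ _ _ (nbhs t) _ y) => e e0.
  pose E := expR (2 * K * Num.max 0 (t + 1)).
  have [k kP] := small (e / 4) (2 * C * E) (ltac:(by rewrite divr_gt0)).
  have yYE (s : R) : s <= t + 1 -> `|y s - Y k (Num.max 0 s)| <= e / 4.
    move=> st; rewrite -y_max (le_trans (yY _ k _)) ?le_max ?lexx//.
    rewrite (le_trans _ (ltW kP))// mulrAC ler_wpM2r ?exprn_ge0//.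
    rewrite ler_wpM2l//; first by rewrite mulr_ge0.
    rewrite /E ler_expR ler_pM2l ?mulr_gt0//.
    by rewrite ge_max le_max lexx/= le_max st orbT.
  have Ymc : continuous (fun s : R => Y k (Num.max 0 s)).
    by move=> s; apply: (continuous_comp (@continuous_max0 R s)); exact: Yc.
  near=> s.
  have s1 : s <= t + 1 by near: s; apply: lt_le_nbhsl; lra.
  have Yts : `|Y k (Num.max 0 t) - Y k (Num.max 0 s)| <= e / 4.
    by near: s; apply: cvgr_dist_le; [exact: Ymc|rewrite divr_gt0].
  have t1 : t <= t + 1 by lra.
  rewrite -(subrKA (Y k (Num.max 0 t))) (le_trans (ler_normD _ _))//.
  rewrite -(subrKA (Y k (Num.max 0 s)) (Y k _)).
  have := ler_normD (Y k (Num.max 0 t) - Y k (Num.max 0 s))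
    (Y k (Num.max 0 s) - y s).
  have := yYE t t1; have := yYE s s1; rewrite (distrC (y s)); lra.
have [z0 dz] := stepP y yc.
(* The witness is [step y], whose derivative is known by construction; it remains to see that [y] is
   a fixed point at nonnegative times. *)
exists (step y) => // t; suff -> : step y (Num.max 0 t) = y (Num.max 0 t) by [].
have : 0 <= Num.max 0 t by rewrite le_max lexx.
move: (Num.max 0 t) => {}t t0.
apply/eqP; rewrite -subr_eq0 -normr_le0; apply: (le0_geometric
  (A := 2 * C * expR (2 * K * t))) => k.
have yYs (s : R) : 0 <= s <= t ->
    `|y s - Y k s| <= 2 * C * 2^-1 ^+ k * expR (2 * K * s).
  by move=> /andP[s0 _]; exact: yY.
have := step_contract _ _ _ _ yc (Yc k) t0 yYs.
have := yY t k.+1 t0; rewrite exprS -[step (Y k)]/(Y k.+1).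
rewrite -[in X in _ -> _ -> X](subrKA (Y k.+1 t)) => H1 H2.
by rewrite (le_trans (ler_normD _ _))// (distrC _ (y t)); lra.
Unshelve. all: by end_near. Qed.

(** * The Euclidean norm and its comparison with the sup norm *)

Section euclidean_norm.
Variables (R : realType) (n : nat).
Implicit Types (u v w : 'rV[R]_n) (a : R).

Lemma dotC u v : dot u v = dot v u.
Proof. by apply: eq_bigr => i _; rewrite mulrC. Qed.

Lemma dotDl u v w : dot (u + v) w = dot u w + dot v w.
Proof. by rewrite -big_split/=; apply: eq_bigr => i _; rewrite mxE mulrDl. Qed.

Lemma dotZl a u v : dot (a *: u) v = a * dot u v.
Proof. by rewrite mulr_sumr; apply: eq_bigr => i _; rewrite mxE mulrA. Qed.

Lemma dotNl u v : dot (- u) v = - dot u v.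
Proof. by rewrite -scaleN1r dotZl mulN1r. Qed.

Lemma dotZr a u v : dot u (a *: v) = a * dot u v.
Proof. by rewrite dotC dotZl dotC. Qed.

Lemma dotDr u v w : dot u (v + w) = dot u v + dot u w.
Proof. by rewrite dotC dotDl !(dotC u). Qed.

Lemma dotNr u v : dot u (- v) = - dot u v.
Proof. by rewrite dotC dotNl dotC. Qed.

Lemma dot0r u : dot u 0 = 0.
Proof. by rewrite -(scale0r 0) dotZr mul0r. Qed.

Lemma dot_ge0 u : 0 <= dot u u.
Proof. by apply: sumr_ge0 => i _; rewrite -expr2 sqr_ge0. Qed.

Lemma enorm_ge0 u : 0 <= enorm u.
Proof. exact: sqrtr_ge0. Qed.

Lemma sqr_enorm u : enorm u ^+ 2 = dot u u.
Proof. by rewrite sqr_sqrtr// dot_ge0. Qed.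

Lemma enorm0 : enorm (0 : 'rV[R]_n) = 0.
Proof. by rewrite /enorm dot0r sqrtr0. Qed.

Lemma enormN u : enorm (- u) = enorm u.
Proof. by rewrite /enorm dotNl dotC dotNl opprK. Qed.

Lemma enormZ a u : enorm (a *: u) = `|a| * enorm u.
Proof.
by rewrite /enorm dotZl dotZr mulrA -expr2 sqrtrM ?sqr_ge0// sqrtr_sqr.
Qed.

Lemma coord_le_enorm u i : `|u ord0 i| <= enorm u.
Proof.
rewrite -sqrtr_sqr ler_sqrt ?dot_ge0// /dot (bigD1 i)//= -expr2 lerDl.
by apply: sumr_ge0 => j _; rewrite -expr2 sqr_ge0.
Qed.

Lemma normr_le_enorm u : `|u| <= enorm u.
Proof.
rewrite {1}/Num.Def.normr/= mx_normrE bigmax_le ?enorm_ge0// => -[i j] _ /=.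
by rewrite ord1 coord_le_enorm.
Qed.

(** The crude factor [n], instead of its square root, is enough to carry the Lipschitz bound over to
    the sup norm. *)
Lemma enorm_le_normr u : enorm u <= n%:R * `|u|.
Proof.
rewrite -[leRHS]ger0_norm ?mulr_ge0// -sqrtr_sqr ler_sqrt ?sqr_ge0//.
apply: (@le_trans _ _ (n%:R * `|u| ^+ 2)).
  have -> : n%:R * `|u| ^+ 2 = \sum_(i < n) `|u| ^+ 2.
    by rewrite sumr_const card_ord mulr_natl.
  apply: ler_sum => i _.
  by rewrite -expr2 -real_normK ?num_real// ler_sqr ?nnegrE// coord_le_normr.
rewrite exprMn ler_wpM2r ?sqr_ge0// -natrX ler_nat.
by case: (n) => // m; rewrite expnS expn1 leq_pmull.
Qed.

Lemma enorm_eq0 u : (enorm u == 0) = (u == 0).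
Proof.
apply/idP/idP => [/eqP u0|/eqP->]; last by rewrite enorm0.
by rewrite -normr_le0 -u0 normr_le_enorm.
Qed.

Lemma enorm_gt0 u : (0 < enorm u) = (u != 0).
Proof. by rewrite lt_neqAle enorm_ge0 andbT eq_sym enorm_eq0. Qed.

(** Cauchy-Schwarz: the squared norm of [enorm v *: u - enorm u *: v] equals [2 * enorm u * enorm v
    * (enorm u * enorm v - dot u v)]. *)
Lemma dot_le_enorm u v : dot u v <= enorm u * enorm v.
Proof.
have [->|v0] := eqVneq v 0; first by rewrite dot0r enorm0 mulr0.
have [->|u0] := eqVneq u 0; first by rewrite dotC dot0r enorm0 mul0r.
have {}u0 : 0 < enorm u by rewrite enorm_gt0.
have {}v0 : 0 < enorm v by rewrite enorm_gt0.
have := dot_ge0 (enorm v *: u - enorm u *: v).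
rewrite dotDl !dotDr !dotNl !dotNr !dotZl !dotZr -!sqr_enorm (dotC v u).
have uv0 : 0 < enorm u * enorm v by rewrite mulr_gt0.
move=> H; rewrite -subr_ge0 -(pmulr_rge0 _ uv0); lra.
Qed.

Lemma continuous_enorm : continuous (@enorm R n).
Proof.
move=> u; apply: (@continuous_comp _ _ _ (fun v => dot v v) Num.sqrt).
  apply: continuous_big; first exact: add_continuous.
  move=> i _ v; have ci := @coord_continuous R 1 n ord0 i v.
  exact: (cvgM ci ci).
exact: sqrt_continuous.
Qed.

(** The square keeps the norm derivable even where the curve vanishes, as the Gronwall arguments
    require. *)
Lemma is_derive1_sqr_enorm (x : R -> 'rV[R]_n) (t : R) v :
  is_derive t (1 : R) x v ->
  is_derive t (1 : R) (fun s => enorm (x s) ^+ 2) (2 * dot (x t) v).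
Proof.
move=> /is_derive_rowP dx.
have := is_derive_sum (fun i => is_deriveM (dx i) (dx i)).
rewrite [X in is_derive _ _ X _ -> _](_ : _ = fun s => enorm (x s) ^+ 2).
  move=> H; refine (is_derive_eq H _).
  rewrite mulr_sumr; apply: eq_bigr => i _.
  by rewrite /GRing.scale/= mulrDl mul1r.
by apply/funext => s; rewrite fct_sumE sqr_enorm.
Qed.

End euclidean_norm.

(** * Gronwall's inequality, inversion of a clock, and derivability at an extinction time *)

Lemma gronwall (R : realType) (u u' S s' : R -> R) (c a b : R) : a <= b ->
  (forall t : R, a <= t <= b -> is_derive t (1 : R) u (u' t)) ->
  (forall t : R, a <= t <= b -> is_derive t (1 : R) S (s' t)) ->
  (forall t : R, a <= t <= b -> u' t <= c * s' t * u t) ->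
  u b * expR (- c * S b) <= u a * expR (- c * S a).
Proof.
move=> ab du dS us.
rewrite -lerN2.
have dE t : a <= t <= b ->
    is_derive t (1 : R) (fun r => expR (- c * S r))
      (expR (- c * S t) * (- c * s' t)).
  by move=> tab; exact: (is_derive1_comp (is_derive_expR _)
    (is_deriveZ (- c) (dS t tab))).
have := is_derive1_nondecreasing ab
  (fun t tab => is_deriveN (is_deriveM (du t tab) (dE t tab))).
apply => t tab; have := us t tab; have := expR_gt0 (- c * S t).
move: (expR _) => E E0 H; rewrite /GRing.scale/=.
(* This is the derivative of [- u * expR (- c * S)]; the sign of [u] does not matter, so lower
   bounds can be obtained too. *)
suff : 0 <= E * (c * s' t * u t - u' t) by lra.
apply: mulr_ge0; [exact: ltW|by rewrite subr_ge0].
Qed.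

(** [T] is the supremum of [tau], not attained since [tau] increases strictly. As [p] is constant on
    negative times, [tau] is linear there and its range is []-oo, T[]; hence [S] has a two-sided
    derivative at 0 as well. *)
Lemma increasing_clock_inverse (R : realType) (tau p : R -> R) (B : R) :
  (forall s : R, is_derive s (1 : R) tau (p s)) -> (forall s, 0 < p s) ->
  (forall s, s <= 0 -> p s = p 0) -> tau 0 = 0 -> (forall s, tau s <= B) ->
  exists T (S : R -> R), [/\ 0 < T, forall s, tau s < T, cancel tau S,
    forall t, t < T -> tau (S t) = t &
    forall s : R, is_derive (tau s) (1 : R) S (p s)^-1].
Proof.
move=> dtau p0 pN tau0 tauB.
have tau_incr a b : a < b -> tau a < tau b.
  by move=> ab; exact: (is_derive1_increasing ab (fun s _ => dtau s)).
have tau_cont : continuous tau.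
  by move=> s; exact: is_derive1_continuous (dtau s).
have tau_inj : injective tau.
  by move=> a b; case: (ltgtP a b) => // /tau_incr + E; rewrite E ltxx.
pose T := sup (range tau).
have supT : has_sup (range tau).
  by split; [exists (tau 0), 0|exists B => _ [s _ <-]].
have tauT s : tau s < T.
  apply: (lt_le_trans (tau_incr s (s + 1) _)); first by rewrite ltrDl.
  by apply: sup_upper_bound => //; exists (s + 1).
have T0 : 0 < T by rewrite -tau0.
have above t : t < T -> exists2 b, 0 <= b & t < tau b.
  move=> tT; have [_ [b _ <-] tb] := sup_gt supT.1 tT.
  exists (Num.max 0 b); first by rewrite le_max lexx.
  rewrite (lt_le_trans tb)//; case: (leP 0 b) => // /tau_incr; exact: ltW.
have below t : exists2 a, a <= 0 & tau a <= t.
  have [t0|t0] := leP 0 t; first by exists 0; rewrite ?tau0.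
  (* On negative times [tau s] is [p 0 * s], which takes the value [t] at [t / p 0]. *)
  have a0 : t / p 0 <= 0 by rewrite pmulr_lle0 ?invr_gt0// ltW.
  exists (t / p 0) => //.
  have H := is_derive1_nondecreasing a0
    (fun s _ => is_deriveB (dtau s)
      (is_deriveZ (p 0) (is_derive_id s (1 : R)))).
  have : tau (t / p 0) - p 0 * (t / p 0) <= tau 0 - p 0 * 0.
    by apply: H => s /andP[_ s0]; rewrite pN// /GRing.scale/= mulr1 subrr.
  have -> : p 0 * (t / p 0) = t by rewrite mulrCA mulfV ?mulr1// gt_eqF.
  by rewrite tau0 mulr0; lra.
have surj t : exists s, t < T -> tau s = t.
  have [tT|] := boolP (t < T); last by exists 0.
  have [b b0 tb] := above t tT; have [a a0 ta] := below t.
  have [||s _ <-] := @IVT R tau a b t (le_trans a0 b0).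
  - exact: continuous_subspaceT.
  - by rewrite ge_min ta le_max (ltW tb) orbT.
  - by exists s.
pose S t := sval (cid (surj t)).
have tauK t : t < T -> tau (S t) = t by rewrite /S; case: cid.
have SK : cancel tau S by move=> s; apply: tau_inj; rewrite tauK.
exists T, S; split=> // s.
apply: is_derive_inverse; last by rewrite gt_eqF.
- by near=> r; exact: SK.
- by near=> r; exact: tau_cont.
Unshelve. all: by end_near. Qed.

(** The mean value inequality on [[t, r]], with [r] tending to [T] from the left, gives
    [|x t| <= e * (T - t)]: the left difference quotient at [T] is small, and the right one is
    zero. *)
Lemma is_derive1_vanishing (R : realType) (n : nat) (x x' : R -> 'rV[R]_n)
    (T : R) :
  (forall t, T <= t -> x t = 0) ->
  (\forall t \near T, t < T -> is_derive t (1 : R) x (x' t)) ->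
  (forall e, 0 < e -> \forall t \near T, t < T -> `|x t| <= e) ->
  (forall e, 0 < e -> \forall t \near T, t < T -> `|x' t| <= e) ->
  is_derive T (1 : R) x 0.
Proof.
move=> xT dx x0 x'0; apply/is_derive1P/cvgrPdist_le => e e0.
have [d d0 dP] : exists2 d : R, 0 < d & forall t, T - d < t -> t < T ->
    is_derive t (1 : R) x (x' t) /\ `|x' t| <= e.
  have [d /= d0 dP] : \forall t \near T, t < T ->
      is_derive t (1 : R) x (x' t) /\ `|x' t| <= e.
    have {}x'0 := x'0 _ e0; near=> t => tT; split; first exact: (near dx t).
    exact: (near x'0 t).
  exists d => // t tl tr; apply: dP => //=; rewrite ltr_norml; lra.
have slope t : T - d < t -> t < T -> `|x t| <= e * (T - t).
  move=> tl tr; apply/ler_addgt0Pr => c c0.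
  have [b /= b0 bP] := x0 _ c0.
  (* A time in [[t, T[] close enough to [T] for [|x r| <= c]. *)
  pose r := Num.max t (T - b / 2).
  have [tr' rT] : t <= r /\ r < T.
    by rewrite le_max lexx gt_max tr/=; split => //; lra.
  have rc : `|x r| <= c.
    apply: bP => //=; rewrite ger0_norm ?subr_ge0 ?(ltW rT)//.
    have : T - b / 2 <= r by rewrite le_max lexx orbT.
    lra.
  have rd s : t <= s <= r -> T - d < s /\ s < T by move=> /andP[]; lra.
  have de s : t <= s <= r -> is_derive s (1 : R) (e \*: (@id R)) e.
    move=> _; apply: (is_derive_eq (is_deriveZ e (is_derive_id s (1 : R)))).
    by rewrite /GRing.scale/= mulr1.
  have dxr s (sr : t <= s <= r) := (dP s (rd s sr).1 (rd s sr).2).1.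
  have x'e s (sr : t <= s <= r) := (dP s (rd s sr).1 (rd s sr).2).2.
  have := mvt_norm tr' dxr de x'e; rewrite /= /GRing.scale/= => H.
  rewrite -[x t](subrK (x r)) (le_trans (ler_normD _ _))// lerD//.
  rewrite distrC (le_trans H)// -mulrBr ler_pM2l//; lra.
rewrite near_withinE; near=> h => h0.
rewrite sub0r normrN (xT T)// subr0 normrZ normfV.
have [hT|hT] := leP T (T + h); first by rewrite xT// normr0 mulr0 ltW.
have {}h0 : h < 0 by lra.
rewrite ler_pdivrMl ?normr_gt0 ?lt_eqF// ltr0_norm// mulrC.
have -> : - h = T - (T + h) by ring.
apply: slope => //; suff : `|h| < d by rewrite ltr_norml => /andP[]; lra.
by near: h; apply: (@nbhs0_lt R R^o).
Unshelve. all: by end_near. Qed.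

(** * Lyapunov estimates for [F] and for the rescaled field [G] *)

Section lyapunov.
Variables (R : realType) (n : nat) (F : 'rV[R]_n -> 'rV[R]_n) (L : R)
  (V : 'rV[R]_n -> R) (k1 k2 k3 eta lambda : R).
Hypotheses (F0 : F 0 = 0) (L_gt0 : 0 < L) (F_lip : lipschitz_modulus F L)
  (k1_gt0 : 0 < k1) (k2_gt0 : 0 < k2) (k3_gt0 : 0 < k3)
  (V_lyap : exponential_lyapunov_function F V k1 k2 k3)
  (eta_gt0 : 0 < eta) (lambda01 : 0 < lambda < 1).

Let G := fun x => sigma F eta lambda x *: F x.

Let W u := V u `^ (lambda / 2).

(** The decay rate of [W] per unit of rescaled time: [W] loses at least [rate * (tau b - tau a)]
    along [y' = F y] between times [a <= b], and at least [rate * t] along [G] during a time [t]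
    spent off the origin. *)
Let rate := k3 * eta * lambda / (2 * k2 `^ (1 - lambda / 2) * L `^ lambda).

Lemma lambda_gt0 : 0 < lambda.
Proof. by case/andP: lambda01. Qed.

Lemma enormF_le u : enorm (F u) <= L * enorm u.
Proof. by have := F_lip u 0; rewrite F0 !subr0. Qed.

(** If [F u = 0], the decrease condition on [V] reads [0 <= - k3 * enorm u ^+ 2], which forces
    [u = 0]. So [sigma] vanishes at the origin alone. *)
Lemma F_eq0 u : (F u == 0) = (u == 0).
Proof.
apply/idP/idP => [/eqP Fu|/eqP->]; last by rewrite F0.
have [_ _ /(_ u)] := V_lyap; rewrite Fu dot0r mulNr oppr_ge0.
by rewrite pmulr_rle0// le_eqVlt ltNge sqr_ge0 orbF sqrf_eq0 enorm_eq0.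
Qed.

Lemma enormF_gt0 u : u != 0 -> 0 < enorm (F u).
Proof. by rewrite enorm_gt0 F_eq0. Qed.

Lemma V_gt0 u : u != 0 -> 0 < V u.
Proof.
move=> u0; have [_ /(_ u)/andP[+ _] _] := V_lyap; apply: lt_le_trans.
by rewrite mulr_gt0// exprn_gt0// enorm_gt0.
Qed.

Lemma V0 : V 0 = 0.
Proof.
have [_ /(_ 0) + _] := V_lyap; rewrite enorm0 expr0n/= !mulr0.
by rewrite -eq_le => /eqP.
Qed.

Lemma G0 : G 0 = 0.
Proof. by rewrite /G F0 scaler0. Qed.

Lemma GE u : u != 0 -> G u = (eta * enorm (F u) `^ (- lambda)) *: F u.
Proof. by rewrite /G /sigma F_eq0 => /negPf->. Qed.

Lemma is_derive1_V (x : R -> 'rV[R]_n) (t : R) v :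
  is_derive t (1 : R) x v ->
  is_derive t (1 : R) (fun s => V (x s)) (dot (gradient V (x t)) v).
Proof. by have [[dV _] _ _] := V_lyap; exact: is_derive1_gradient. Qed.

Lemma dot_gradient_G_le0 u : dot (gradient V u) (G u) <= 0.
Proof.
have [->|u0] := eqVneq u 0; first by rewrite G0 dot0r.
have [_ _ /(_ u) Vu] := V_lyap.
rewrite GE// dotZr pmulr_rle0 ?mulr_gt0 ?powR_gt0 ?enormF_gt0//.
by rewrite (le_trans Vu)// mulNr oppr_le0 mulr_ge0 ?sqr_ge0// ltW.
Qed.

Lemma V_nonincreasing z s t : prolonged_solution G z -> 0 <= s -> s <= t ->
  V (z t) <= V (z s).
Proof.
move=> dz s0 st; rewrite -lerN2.
apply: (is_derive1_nondecreasing st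
  (fun r _ => is_deriveN (is_derive1_V (dz r)))) => r /andP[sr _].
by rewrite (max_idPr (le_trans s0 sr)) oppr_ge0 dot_gradient_G_le0.
Qed.

(** Uniqueness forward from the origin, where [G] may fail to be Lipschitz, follows from [V] being
    positive definite and nonincreasing. *)
Lemma solution_stays_0 z s t : prolonged_solution G z -> 0 <= s -> s <= t ->
  z s = 0 -> z t = 0.
Proof.
move=> dz s0 st zs; apply/eqP/negPn/negP => /V_gt0.
by rewrite ltNge -V0 -zs V_nonincreasing.
Qed.

Lemma G_lyapunov_stable : lyapunov_stable G.
Proof.
(* This [delta] satisfies [k2 * delta ^+ 2 = k1 * eps ^+ 2], which closes the chain from
   [k1 * enorm (z t) ^+ 2] to [V (z t)], [V (z 0)] and [k2 * enorm (z 0) ^+ 2]. *)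
move=> eps eps0; exists (eps * Num.sqrt (k1 / k2)).
  by rewrite mulr_gt0// sqrtr_gt0 divr_gt0.
move=> x /solution_prolong[z zx dz]; rewrite -(zx 0)// => x0 t t0.
rewrite -zx// -(ltr_pXn2r (n := 2))// ?nnegrE ?enorm_ge0 ?(ltW eps0)//.
rewrite -(ltr_pM2l k1_gt0).
have [_ Vb _] := V_lyap.
have /andP[Vt _] := Vb (z t); have /andP[_ V0] := Vb (z 0).
apply: (le_lt_trans Vt); apply: (le_lt_trans (V_nonincreasing dz (lexx 0) t0)).
apply: (le_lt_trans V0).
have -> : k1 * eps ^+ 2 = k2 * (eps * Num.sqrt (k1 / k2)) ^+ 2.
  by rewrite exprMn sqr_sqrtr ?divr_ge0 ?ltW//; field; rewrite gt_eqF.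
by rewrite ltr_pM2l// ltr_pXn2r// nnegrE ?enorm_ge0// mulr_ge0 ?sqrtr_ge0 ?ltW.
Qed.

Lemma rate_gt0 : 0 < rate.
Proof. by rewrite divr_gt0 ?mulr_gt0 ?powR_gt0 ?lambda_gt0. Qed.

Lemma is_derive1_W (x : R -> 'rV[R]_n) (t : R) v : x t != 0 ->
  is_derive t (1 : R) x v ->
  is_derive t (1 : R) (fun s => W (x s))
    (lambda / 2 * V (x t) `^ (lambda / 2 - 1) * dot (gradient V (x t)) v).
Proof.
move=> /V_gt0 Vx dx.
exact: (is_derive1_comp (is_derive1_powR _ Vx) (is_derive1_V dx)).
Qed.

(** With [p = 1 - lambda / 2], the bound [V u <= k2 * enorm u ^+ 2] raised to the power [- p] gives
    [V u ^ (- p) * enorm u ^+ 2 >= k2 ^ (- p) * enorm u ^ lambda], and [enorm u ^ lambda] dominates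
    [enorm (F u) ^ lambda / L ^ lambda]. *)
Lemma W_decay u : u != 0 ->
  lambda / 2 * V u `^ (lambda / 2 - 1) * dot (gradient V u) (F u) <=
  - rate * (enorm (F u) `^ lambda / eta).
Proof.
move=> u0; have lambda0 := lambda_gt0; have [_ Vb Vd] := V_lyap.
have N0 : 0 < enorm u by rewrite enorm_gt0.
pose p := 1 - lambda / 2.
have p0 : 0 <= p by rewrite /p; case/andP: lambda01; lra.
have -> : lambda / 2 - 1 = - p by rewrite /p; ring.
have Vp : (k2 * enorm u ^+ 2) `^ (- p) <= V u `^ (- p).
  rewrite !powRN lef_pV2 ?posrE ?powR_gt0 ?V_gt0 ?mulr_gt0 ?exprn_gt0//.
  apply: ge0_ler_powR => //; rewrite ?nnegrE ?(ltW (V_gt0 u0))//.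
    by rewrite mulr_ge0 ?sqr_ge0// ltW.
  by case/andP: (Vb u).
have {}Vp : k2 `^ (- p) * enorm u `^ lambda <= V u `^ (- p) * enorm u ^+ 2.
  apply: le_trans (ler_wpM2r (sqr_ge0 _) Vp).
  rewrite powRM ?sqr_ge0 ?(ltW k2_gt0)// -mulrA ler_pM2l ?powR_gt0//.
  rewrite -powR_mulrn ?enorm_ge0// -powRrM -powRD ?(gt_eqF N0) ?implybT//.
  by rewrite (_ : 2 * - p + 2 = lambda)// /p; field.
have FL : enorm (F u) `^ lambda <= L `^ lambda * enorm u `^ lambda.
  rewrite -powRM ?enorm_ge0 ?(ltW L_gt0)//.
  apply: ge0_ler_powR; rewrite ?nnegrE ?enorm_ge0 ?(ltW lambda0) ?enormF_le//.
  by rewrite mulr_ge0 ?enorm_ge0// ltW.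
have lhs : lambda / 2 * V u `^ (- p) * dot (gradient V u) (F u) <=
    - (lambda / 2 * k3 * (V u `^ (- p) * enorm u ^+ 2)).
  have -> : - (lambda / 2 * k3 * (V u `^ (- p) * enorm u ^+ 2)) =
    lambda / 2 * V u `^ (- p) * (- k3 * enorm u ^+ 2) by ring.
  by apply: ler_wpM2l; rewrite // !mulr_ge0 ?powR_ge0 ?(ltW lambda0).
apply: (le_trans lhs); rewrite mulNr lerN2.
apply: (@le_trans _ _ (lambda / 2 * k3 * (k2 `^ (- p) * enorm u `^ lambda))).
  have -> : lambda / 2 * k3 * (k2 `^ (- p) * enorm u `^ lambda) =
      rate * (L `^ lambda * enorm u `^ lambda / eta).
    rewrite powRN /rate -/p; field.
    by rewrite !gt_eqF ?powR_gt0.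
  by rewrite ler_pM2l ?rate_gt0// ler_pM2r ?invr_gt0.
by apply: ler_wpM2l; rewrite // mulr_ge0 ?divr_ge0 ?ltW.
Qed.

Lemma W_ge0 u : 0 <= W u.
Proof. exact: powR_ge0. Qed.

Lemma W_le u : W u <= k2 `^ (lambda / 2) * enorm u `^ lambda.
Proof.
have [_ /(_ u)/andP[Vl Vu] _] := V_lyap; have lambda0 := lambda_gt0.
have -> : enorm u `^ lambda = (enorm u ^+ 2) `^ (lambda / 2).
  by rewrite -powR_mulrn ?enorm_ge0// -powRrM; congr (_ `^ _); field.
rewrite -(powRM _ (ltW k2_gt0) (sqr_ge0 _)).
have l0 : 0 <= lambda / 2 by rewrite divr_ge0 ?ltW.
by apply: ge0_ler_powR => //; rewrite nnegrE; [apply: le_trans Vl|];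
  rewrite mulr_ge0 ?sqr_ge0 ?ltW.
Qed.

Lemma W_rate_le u : W u / rate <=
  2 * k2 * L `^ lambda / (k3 * eta * lambda) * enorm u `^ lambda.
Proof.
have lambda0 := lambda_gt0.
rewrite ler_pdivrMr ?rate_gt0//; apply: (le_trans (W_le u)).
rewrite /rate; set p := lambda / 2.
(* One factor comes from the upper bound on [W], the other from [rate]; together they give the plain
   [k2] of the final bound. *)
have k2E : k2 = k2 `^ p * k2 `^ (1 - p).
  by rewrite -powRD ?(gt_eqF k2_gt0) ?implybT// addrC subrK powRr1 ?ltW.
rewrite [X in 2 * X]k2E.
have -> : 2 * (k2 `^ p * k2 `^ (1 - p)) * L `^ lambda / (k3 * eta * lambda) *
    enorm u `^ lambda * (k3 * eta * lambda / (2 * k2 `^ (1 - p) * L `^ lambda))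
    = k2 `^ p * enorm u `^ lambda.
  by field; rewrite !gt_eqF ?powR_gt0.
by [].
Qed.

(** Off the origin the factor [eta * enorm (F u) ^ (- lambda)] cancels the speed in [W_decay], so
    [W (z s) + rate * s] is nonincreasing, while [W] stays nonnegative. *)
Lemma nonvanishing_time_le z t : prolonged_solution G z -> 0 <= t ->
  (forall s, 0 <= s <= t -> z s != 0) -> t <= W (z 0) / rate.
Proof.
move=> dz t0 z0; rewrite ler_pdivlMr ?rate_gt0//.
have dW (s : R) (st : 0 <= s <= t) := is_deriveN (is_deriveD
  (is_derive1_W (z0 s st) (dz s)) (is_deriveZ rate (is_derive_id s (1 : R)))).
have H := is_derive1_nondecreasing t0 dW.
have : W (z t) + rate * t <= W (z 0) + rate * 0.
  rewrite -lerN2; apply: H => s /[dup] st /andP[s0 _].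
  have N0 := enormF_gt0 (z0 s st).
  rewrite (max_idPr s0) oppr_ge0 GE ?z0// dotZr /GRing.scale/= mulr1.
  have c0 : 0 <= eta * enorm (F (z s)) `^ (- lambda).
    by rewrite mulr_ge0 ?powR_ge0// ltW.
  have := ler_wpM2l c0 (W_decay (z0 s st)).
  have -> : eta * enorm (F (z s)) `^ (- lambda) *
      (- rate * (enorm (F (z s)) `^ lambda / eta)) = - rate.
    by rewrite powRN; field; rewrite !gt_eqF ?powR_gt0.
  lra.
by have := W_ge0 (z t); lra.
Qed.

(** * The flow of [F] and the time change *)

Lemma lipschitz_normr u v : `|F u - F v| <= L * n.+1%:R * `|u - v|.
Proof.
(* The factor [n.+1], not [n], keeps the modulus positive in dimension 0. *)
rewrite (le_trans (normr_le_enorm _))// (le_trans (F_lip _ _))// -mulrA.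
by rewrite ler_pM2l// (le_trans (enorm_le_normr _))// ler_wpM2r// ler_nat.
Qed.

Lemma continuous_F : continuous F.
Proof.
by apply: lipschitz_normr_continuous lipschitz_normr; rewrite mulr_gt0.
Qed.

Lemma F_solution_exists x0 :
  exists2 y : R -> 'rV[R]_n, y 0 = x0 & prolonged_solution F y.
Proof. by apply: picard lipschitz_normr; rewrite mulr_gt0. Qed.

Lemma F_solution_neq0 y s : prolonged_solution F y -> y 0 != 0 -> 0 <= s ->
  y s != 0.
Proof.
move=> dy y0 s0; apply/eqP => ys.
(* Gronwall applied to minus the squared norm yields a lower bound:
   [enorm (y s) ^+ 2 * expR (2 * L * s)] is at least [enorm (y 0) ^+ 2]. *)
have := gronwall (c := - 2 * L) s0
  (fun r _ => is_deriveN (is_derive1_sqr_enorm (dy r)))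
  (fun r _ => is_derive_id r (1 : R)) => H.
have {H} : - (enorm (y s) ^+ 2) * expR (- (- 2 * L) * s) <=
    - (enorm (y 0) ^+ 2) * expR (- (- 2 * L) * 0).
  apply: H => r /andP[r0 _]; rewrite (max_idPr r0) fctE.
  have := dot_le_enorm (y r) (- F (y r)); rewrite dotNr enormN.
  have := ler_wpM2l (enorm_ge0 (y r)) (enormF_le (y r)).
  by rewrite expr2; lra.
rewrite ys enorm0 expr0n/= !mulr0 expR0 oppr0 mul0r mulr1 oppr_ge0.
by rewrite leNgt exprn_gt0// enorm_gt0.
Qed.

Lemma continuous_powR_enormF (z : R -> 'rV[R]_n) (a : R) : continuous z ->
  (forall s, z s != 0) -> continuous (fun s => enorm (F (z s)) `^ a).
Proof.
move=> zc z0 s.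
apply: (@continuous_comp _ _ _ (fun s => enorm (F (z s)))
  (fun r : R => r `^ a)).
  apply: (@continuous_comp _ _ _ (F \o z) (@enorm R n)).
    by apply: continuous_comp; [exact: zc|exact: continuous_F].
  exact: continuous_enorm.
have /(is_derive1_powR a) := enormF_gt0 (z0 s).
exact: is_derive1_continuous.
Qed.

(* Along [y' = F y], the time needed by the finite-time system to go from [y 0]
   to [y s]. *)
Lemma clock_exists y : prolonged_solution F y -> y 0 != 0 ->
  exists2 tau : R -> R, tau 0 = 0 & forall s : R,
    is_derive s (1 : R) tau (enorm (F (y (Num.max 0 s))) `^ lambda / eta).
Proof.
move=> dy y0.
have yc : continuous y by move=> s; exact: is_derive1_continuous (dy s).
have [|tau tau0 dtau] := @continuous_antiderivative R
    (fun s => enorm (F (y (Num.max 0 s))) `^ lambda / eta).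
  move=> s; apply: cvgM; last exact: cvg_cst.
  apply: continuous_powR_enormF => [r|r].
    by apply: (continuous_comp (@continuous_max0 R r)); exact: yc.
  by rewrite F_solution_neq0// le_max lexx.
exists tau => [|s]; first exact: tau0.
by have := dtau s; rewrite maxA maxxx; exact: id.
Qed.

Lemma clock_bounded y tau s : prolonged_solution F y -> y 0 != 0 ->
  tau 0 = 0 -> (forall s : R,
    is_derive s (1 : R) tau (enorm (F (y (Num.max 0 s))) `^ lambda / eta)) ->
  0 <= s -> tau s <= W (y 0) / rate.
Proof.
move=> dy y0 tau0 dtau s0.
rewrite ler_pdivlMr ?rate_gt0//.
have yn0 r (rs : 0 <= r <= s) : y r != 0.
  by rewrite F_solution_neq0//; case/andP: rs.
have dW (r : R) (rs : 0 <= r <= s) := is_deriveN (is_deriveD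
  (is_derive1_W (yn0 r rs) (dy r))
  (is_deriveZ rate (dtau r))).
have H := is_derive1_nondecreasing s0 dW.
have : W (y s) + rate * tau s <= W (y 0) + rate * tau 0.
  rewrite -lerN2; apply: H => r /[dup] rs /andP[r1 _].
  rewrite (max_idPr r1) oppr_ge0 /GRing.scale/=.
  have := W_decay (yn0 r rs).
  by rewrite -/rate; lra.
by have := W_ge0 (y s); rewrite tau0; lra.
Qed.

(* Every solution of the finite-time system is a reparametrisation [y (S t)] of
   the solution of [y' = F y], by Gronwall's inequality with clock [S]. *)
Lemma solution_reparam y tau z t : prolonged_solution F y -> y 0 != 0 ->
  tau 0 = 0 -> (forall s : R,
    is_derive s (1 : R) tau (enorm (F (y (Num.max 0 s))) `^ lambda / eta)) ->
  prolonged_solution G z -> z 0 = y 0 -> 0 <= t -> z t != 0 ->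
  exists2 s, 0 <= s & z t = y s /\ tau s = t.
Proof.
move=> dy y0 tau0 dtau dz zy0 t0 zt0.
have zn0 r : 0 <= r <= t -> z r != 0.
  move=> /andP[r0 rt]; apply: contra zt0 => /eqP zr.
  by apply/eqP; exact: solution_stays_0 dz r0 rt zr.
have zc : continuous z by move=> r; exact: is_derive1_continuous (dz r).
(* Clamping to [[0, t]], where [z] does not vanish, makes the negative power of [enorm (F z)]
   continuous on the whole line. *)
pose clamp r := Num.min t (Num.max 0 r).
have clampP r : 0 <= clamp r <= t.
  by rewrite le_min t0/= le_max lexx/= ge_min lexx.
have clamp_cont : continuous clamp.
  move=> r; apply: (@continuous_min _ _ (cst t) (fun r : R => Num.max 0 r)).
    exact: cvg_cst.
  exact: continuous_max0.
have [|S S0 dS'] := @continuous_antiderivative R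
    (fun r => enorm (F (z (clamp r))) `^ (- lambda) * eta).
  move=> r; apply: cvgM; last exact: cvg_cst.
  apply: continuous_powR_enormF => [q|q]; last exact/zn0/clampP.
  by apply: (continuous_comp (clamp_cont q)); exact: zc.
have dS r : 0 <= r <= t ->
    is_derive r (1 : R) S (enorm (F (z r)) `^ (- lambda) * eta).
  move=> /andP[r0 rt]; have := dS' r.
  by rewrite /clamp maxA maxxx (max_idPr r0) (min_idPr rt).
have S'0 r : 0 <= enorm (F (z r)) `^ (- lambda) * eta.
  by rewrite mulr_ge0 ?powR_ge0// ltW.
have S_ge0 r : 0 <= r <= t -> 0 <= S r.
  move=> /andP[r0 rt]; rewrite -S0.
  have sub q : 0 <= q <= r -> 0 <= q <= t.
    by move=> /andP[-> qr]; exact: le_trans rt.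
  exact: (is_derive1_nondecreasing r0 (fun q qr => dS q (sub q qr))).
have dyS r (rt : 0 <= r <= t) := is_derive1_reparam (dy (S r)) (dS r rt).
have yS r : 0 <= r <= t -> y (S r) = z r.
  move=> /andP[r0 rt]; apply/eqP; rewrite -subr_eq0 -enorm_eq0.
  have sub q : 0 <= q <= r -> 0 <= q <= t.
    by move=> /andP[-> qr]; exact: le_trans rt.
  (* Both [y (S q)] and [z q] move at speed [s'] times [F]; the possibly non-Lipschitz factor [s']
     is absorbed in the clock, leaving the Lipschitz bound of [F]. *)
  have H := gronwall (c := 2 * L) r0
    (fun q qr => is_derive1_sqr_enorm (is_deriveB (dyS q (sub q qr)) (dz q)))
    (fun q qr => dS q (sub q qr)).
  have {H} : enorm (y (S r) - z r) ^+ 2 * expR (- (2 * L) * S r) <=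
      enorm (y (S 0) - z 0) ^+ 2 * expR (- (2 * L) * S 0).
    apply: H => q qr; have qt := sub q qr; have /andP[q0 _] := qt.
    rewrite (max_idPr q0) (max_idPr (S_ge0 q qt)) GE ?zn0// [eta * _]mulrC.
    rewrite -scalerBr dotZr !fctE.
    set s' := (_ `^ _ * eta); set w := y (S q) - z q.
    have -> : 2 * L * s' * enorm w ^+ 2 = 2 * (s' * (enorm w * (L * enorm w))).
      ring.
    rewrite ler_pM2l// ler_wpM2l ?S'0// (le_trans (dot_le_enorm _ _))//.
    by rewrite ler_wpM2l ?enorm_ge0// F_lip.
  rewrite S0 zy0 subrr enorm0 expr0n/= mul0r pmulr_lle0 ?expR_gt0// => H.
  by rewrite -sqrf_eq0 eq_le H sqr_ge0.
have tt : 0 <= t <= t by rewrite t0 lexx.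
exists (S t); first exact: S_ge0; split; first by rewrite yS.
(* The speeds of [tau] and [S] are inverse to each other along the common orbit, hence
   [tau (S t) = t]. *)
have dtS r (rt : 0 <= r <= t) : is_derive r (1 : R) (tau \o S) 1.
  refine (is_derive_eq (is_derive1_comp (dtau (S r)) (dS r rt)) _).
  rewrite (max_idPr (S_ge0 r rt)) yS// powRN; field.
  by rewrite !gt_eqF ?powR_gt0 ?enormF_gt0 ?zn0.
have := is_derive1_eq_increment t0 dtS (fun r _ => is_derive_id r (1 : R)).
by rewrite /= S0 tau0 !subr0.
Qed.

(** * Construction and uniqueness of finite-time solutions, and their settling time *)

Lemma F_solution_decay y e : globally_exponentially_stable F ->
  prolonged_solution F y -> 0 < e ->
  exists2 s0, 0 <= s0 & forall s, s0 <= s -> enorm (y s) <= e.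
Proof.
move=> [_ [M [rho [M0 rho0 decay]]]] dy e0.
have N0 := enorm_ge0 (y 0).
have s00 : 0 <= M * enorm (y 0) / (rho * e).
  by apply: divr_ge0; apply: mulr_ge0; rewrite // ltW.
(* From [1 + rho * s <= expR (rho * s)], it suffices that [M * enorm (y 0) <= e * rho * s]. *)
exists (M * enorm (y 0) / (rho * e)) => // s s0s.
have s0 : 0 <= s by exact: le_trans s0s.
have soly : solution F y.
  by apply: is_derive1_solution => t t0; have := dy t; rewrite (max_idPr t0).
rewrite (le_trans (decay y soly s s0))// mulrAC mulNr expRN.
rewrite ler_pdivrMr ?expR_gt0//.
have := expR_ge1Dx (rho * s); rewrite -(ler_pM2l e0); apply: le_trans.
rewrite ler_pdivrMr ?mulr_gt0// in s0s; lra.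
Qed.

(** [enorm (G u)] is [eta * enorm (F u) ^ (1 - lambda)] off the origin, with a positive exponent
    because [lambda < 1]. The witness [d] makes this equal to [e] when [enorm (F u) = L * d]. *)
Lemma G_small e : 0 < e ->
  exists2 d, 0 < d & forall u, enorm u <= d -> `|G u| <= e.
Proof.
move=> e0; have [l0 l1] := andP lambda01.
have p0 : 0 < 1 - lambda by lra.
exists ((e / eta) `^ (1 - lambda)^-1 / L) => [|u].
  by rewrite divr_gt0 ?powR_gt0 ?divr_gt0.
rewrite ler_pdivlMr// mulrC => ud.
have [->|u0] := eqVneq u 0; first by rewrite G0 normr0 ltW.
have N0 := enormF_gt0 u0.
rewrite (le_trans (normr_le_enorm _))// GE// enormZ.
rewrite ger0_norm ?mulr_ge0 ?powR_ge0 ?(ltW eta_gt0)// -mulrA -ler_pdivlMl//.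
rewrite -{2}(powRr1 (ltW N0)) -powRD ?(gt_eqF N0) ?implybT// addrC mulrC.
have -> : e / eta = (e / eta) `^ (1 - lambda)^-1 `^ (1 - lambda).
  by rewrite -powRrM mulVf ?gt_eqF// powRr1// divr_ge0 ?ltW.
apply: ge0_ler_powR; rewrite ?nnegrE ?enorm_ge0 ?powR_ge0 ?(ltW p0)//.
exact: le_trans (enormF_le u) ud.
Qed.

(** Agreement is asked only where the competitor [z] does not vanish, which is what the time change
    provides; [V] settles the times where [z] vanishes. *)
Lemma G_the_solution x0 (x : R -> 'rV[R]_n) :
  prolonged_solution G x -> x 0 = x0 ->
  (forall z t, prolonged_solution G z -> z 0 = x0 -> 0 <= t -> z t != 0 ->
    z t = x t) ->
  the_solution G x0 x.
Proof.
move=> dx xx0 uniq; split=> // [|w solw w0 t t0].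
  by apply: is_derive1_solution => t t0; have := dx t; rewrite (max_idPr t0).
have [z zw dz] := solution_prolong solw; rewrite -zw//.
have z0 : z 0 = x0 by rewrite zw.
have [zt|zt] := eqVneq (z t) 0; last exact: uniq.
have [->//|xt] := eqVneq (x t) 0.
(* If [z t = 0 <> x t], then [V (z s) = V (x t) / 2] for some [s <= t], where
   [z s = x s]: impossible since [V] decreases along [x]. *)
have V_cont : continuous (fun s => V (z s)).
  by move=> s; exact: is_derive1_continuous (is_derive1_V (dz s)).
have Vxt := V_gt0 xt.
have Vx0 : V (x t) <= V (z 0).
  by rewrite z0 -xx0 (V_nonincreasing dx).
have [||s] := @IVT R (fun s => V (z s)) 0 t (V (x t) / 2) t0.
- exact: continuous_subspaceT.
- rewrite ge_min le_max zt V0; apply/andP; split; apply/orP; [right|left]; lra.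
rewrite in_itv/= => /andP[s0 st] Vzs.
have zs : z s != 0 by apply/eqP => zs; move: Vzs; rewrite zs V0; lra.
exfalso; have := V_nonincreasing dx s0 st.
by rewrite -(uniq z s dz z0 s0 zs) Vzs; lra.
Qed.

Lemma G_solution_exists x0 : globally_exponentially_stable F -> x0 != 0 ->
  exists T x, [/\ 0 < T, prolonged_solution G x, the_solution G x0 x,
    forall t, T <= t -> x t = 0 & forall t, 0 <= t < T -> x t != 0].
Proof.
move=> F_ges x0n; have [y yx0 dy] := F_solution_exists x0.
have y0 : y 0 != 0 by rewrite yx0.
have [tau tau0 dtau] := clock_exists dy y0.
pose p s := enorm (F (y (Num.max 0 s))) `^ lambda / eta.
have m0 (s : R) : 0 <= Num.max 0 s by rewrite le_max lexx.
have p0 s : 0 < p s.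
  by rewrite divr_gt0// powR_gt0// enormF_gt0// F_solution_neq0.
have tau_le a b : a <= b -> tau a <= tau b.
  move=> ab; apply: (is_derive1_nondecreasing ab (fun s _ => dtau s)) => s _.
  exact: ltW (p0 s).
have tauB s : tau s <= W (y 0) / rate.
  rewrite (@le_trans _ _ (tau (Num.max 0 s)))//.
    by rewrite tau_le// le_max lexx orbT.
  exact: clock_bounded.
have [|T [S [T0 tauT tauK SK dS]]] :=
  increasing_clock_inverse dtau p0 _ tau0 tauB.
  by move=> s s0; rewrite (max_idPl s0) maxxx.
have S_ge t s : t < T -> tau s <= t -> s <= S t.
  move=> tT st; rewrite leNgt; apply/negP => Sts.
  have : tau (S t) < tau s.
    exact: (is_derive1_increasing Sts (fun r _ => dtau r) (fun r _ => p0 r)).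
  by rewrite SK// ltNge st.
have S0 t : 0 <= t -> t < T -> 0 <= S t.
  by move=> t0 tT; apply: S_ge; rewrite ?tau0.
pose x t := if t < T then y (S t) else 0.
have xl t : t < T -> x t = y (S t) by rewrite /x => ->.
have xr t : T <= t -> x t = 0 by rewrite /x ltNge => ->.
have xx0 : x 0 = x0 by rewrite xl// -tau0 tauK.
have dxl t : 0 <= t -> t < T -> is_derive t (1 : R) x (G (x t)).
  move=> t0 tT; have St := S0 t t0 tT.
  apply: (@near_eq_is_derive _ _ _ (fun s => y (S s))).
    near=> s; rewrite xl//; near: s; exact: lt_nbhsl.
  have dSt := dS (S t); rewrite SK// in dSt.
  refine (is_derive_eq (is_derive1_reparam (dy (S t)) dSt) _).
  rewrite (xl _ tT) (GE (F_solution_neq0 dy y0 St)) (max_idPr St).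
  by congr (_ *: _); rewrite invf_div powRN.
(* As [t] approaches [T], it exceeds [tau s0 < T], so [S t >= s0] and the exponential decay of [y]
   applies. *)
have decay e : 0 < e -> \forall t \near T, t < T -> enorm (x t) <= e.
  move=> e0; have [s0 s00 s0P] := F_solution_decay F_ges dy e0.
  near=> t => tT; rewrite xl// s0P// S_ge//.
  by near: t; apply: lt_le_nbhsr; exact: tauT.
(* At the junction with the zero solution the velocity [G (x t)] tends to 0, so [x] still solves the
   equation there. *)
have dxT : is_derive T (1 : R) x 0.
  apply: (is_derive1_vanishing (x' := G \o x)) => //.
  - near=> t => tT; apply: dxl => //.
    by near: t; exact: lt_le_nbhsr.
  - move=> e /decay; apply: filterS => t H /H; apply: le_trans.
    exact: normr_le_enorm.
  - move=> e /G_small[d d0 dP]; move: (decay d d0).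
    by apply: filterS => t H /H /dP.
have dxr t : T < t -> is_derive t (1 : R) x (G (x t)).
  move=> tT; rewrite xr ?ltW// G0.
  apply: near_eq_is_derive (is_derive_cst (0 : 'rV[R]_n) t (1 : R)).
  by near=> s; rewrite xr//; near: s; exact: lt_le_nbhsr.
have dx (t : R) : 0 <= t -> is_derive t (1 : R) x (G (x t)).
  move=> t0; have [tT|tT|->] := ltgtP t T; [exact: dxl|exact: dxr|].
  by rewrite xr// G0.
have [z zx dz] := solution_prolong (is_derive1_solution dx).
exists T, z; split=> //.
- apply: G_the_solution => //; first by rewrite zx.
  move=> w t dw w0 t0 wt; rewrite zx//.
  (* A nonvanishing competitor at time [t] equals [y s] with [tau s = t]; hence [t < T] and
     [s = S t]. *)
  have [|s s0 [-> st]] := solution_reparam dy y0 tau0 dtau dw _ t0 wt.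
    by rewrite w0 yx0.
  by rewrite -st xl// tauK.
- by move=> t tT; rewrite zx ?xr// (le_trans (ltW T0)).
- move=> t /andP[t0 tT]; rewrite zx// xl//.
  exact: F_solution_neq0 dy y0 (S0 t t0 tT).
Unshelve. all: by end_near. Qed.

Lemma G_settling x0 : globally_exponentially_stable F ->
  exists T : R, 0 <= T /\ exists x : R -> 'rV[R]_n,
    [/\ the_solution G x0 x,
      x t @[t --> within [set t | 0 <= t] (nbhs T)] --> (0 : 'rV[R]_n),
      x T = 0 & forall t, 0 <= t < T -> x t <> 0].
Proof.
move=> F_ges; have [->|x0n] := eqVneq x0 0.
  have d0 : prolonged_solution G (cst 0).
    by move=> t; rewrite /= G0; exact: is_derive_cst.
  exists 0; split => //; exists (cst 0); split=> //.
  - apply: G_the_solution => // z t dz z0 t0 zt.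
    exact: solution_stays_0 dz (lexx 0) t0 z0.
  - exact: cvg_cst.
  - by move=> t /andP[t0]; rewrite ltNge t0.
have [T [x [T0 dx solx xT xn]]] := G_solution_exists F_ges x0n.
exists T; split; first exact: ltW.
exists x; split=> //.
- rewrite -(xT T)//; apply: (@cvg_trans _ (x @ nbhs T)).
    by apply: cvg_app; exact: cvg_within.
  exact: is_derive1_continuous (dx T).
- exact: xT.
- by move=> t /xn /eqP.
Qed.

Lemma settling_time_le T x0 : settling_time_function G T ->
  T x0 <= 2 * k2 * L `^ lambda / (k3 * eta * lambda) * enorm x0 `^ lambda.
Proof.
move=> /(_ x0)[T0 [x [[solx xx0 _] _ _ xn]]].
apply: le_trans (W_rate_le x0).
rewrite leNgt; apply/negP => WT.
have W0 : 0 <= W x0 / rate by rewrite divr_ge0 ?W_ge0// ltW// rate_gt0.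
have [z zx dz] := solution_prolong solx.
(* A time strictly between the supposed bound and [T x0]: the solution does not vanish on the closed
   interval [[0, t]], which contradicts [nonvanishing_time_le]. *)
pose t := (W x0 / rate + T x0) / 2.
have t0 : 0 <= t by rewrite /t; lra.
have tT : t < T x0 by rewrite /t; lra.
have : t <= W (z 0) / rate.
  apply: nonvanishing_time_le => // s /andP[s0 st].
  by rewrite zx//; apply/eqP/xn; rewrite s0 (le_lt_trans st).
by rewrite zx// xx0 /t; lra.
Qed.

End lyapunov.

Theorem theorem1 (R : realType) (n : nat) (F : 'rV[R]_n -> 'rV[R]_n) (L : R)
    (V : 'rV[R]_n -> R) (k1 k2 k3 : R) (eta lambda : R)
    (F0 : F 0 = 0)
    (L_gt0 : 0 < L)
    (F_lip : lipschitz_modulus F L)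
    (F_ges : globally_exponentially_stable F)
    (k1_gt0 : 0 < k1) (k2_gt0 : 0 < k2) (k3_gt0 : 0 < k3)
    (V_lyap : exponential_lyapunov_function F V k1 k2 k3)
    (eta_gt0 : 0 < eta)
    (lambda01 : 0 < lambda < 1) :
  let G := fun x => sigma F eta lambda x *: F x in
  globally_finite_time_stable G /\
  forall T, settling_time_function G T ->
    forall x0, T x0 <=
      2 * k2 * L `^ lambda / (k3 * eta * lambda) * enorm x0 `^ lambda.
Proof.
split; last first.
  by move=> T TG x0; apply: settling_time_le V_lyap _ _ _ _ TG.
split; [exact: G0|exact: G_lyapunov_stable V_lyap eta_gt0|].
have /choice[T TP] x0 := G_settling F0 L_gt0 F_lip k1_gt0 k2_gt0 k3_gt0
  V_lyap eta_gt0 lambda01 x0 F_ges.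
by exists T.
Qed.
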